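(* For every inverse semigroup $S$, there exists a multiplier semigroup $M(S)$ of $S$.
   Context: A semigroup $S$ is inverse if every $s\in S$ has a unique $s^*\in S$ with $ss^*s=s$ and $s^*ss^*=s^*$. A two-sided ideal of a semigroup $R$ is a subset $I\subset R$ with $rx\in I$ and $xr\in I$ for all $r\in R$, $x\in I$. The multiplier semigroup $M(S)$ of an inverse semigroup $S$ is an inverse semigroup which includes $S$ as a two-sided ideal (i.e. it comes with an injective semigroup homomorphism from $S$ whose image is a two-sided ideal) and satisfies the following universality: for every inverse semigroup $\widetilde{S}$ which includes $S$ as a two-sided ideal, there exists a unique semigroup homomorphism $\theta:\widetilde{S}\to M(S)$ whose composition with the inclusion $S\hookrightarrow\widetilde{S}$ is the inclusion $S\hookrightarrow M(S)$. *)

(* Defs.v *)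
From mathcomp Require Import all_boot all_classical.

Set Implicit Arguments.
Unset Strict Implicit.
Unset Printing Implicit Defensive.

Local Open Scope group_scope.

(* A [semigroupType] carries a choice structure; classically every type has
   one (see [boolp.gen_eqMixin], [boolp.gen_choiceMixin]), so this is no
   restriction. It may be empty. *)

Definition inverse_semigroup (S : semigroupType) : Prop :=
  forall s : S, exists! t : S, s * t * s = s /\ t * s * t = t.

Definition two_sided_ideal (R : semigroupType) (I : set R) : Prop :=
  forall r x : R, I x -> I (r * x) /\ I (x * r).

Definition ideal_inclusion (S R : semigroupType)
    (f : {multiplicative S -> R}) : Prop :=
  injective f /\ two_sided_ideal (range f).

(* The multiplier semigroup is the pair of [M] and its inclusion [i]. *)
Definition multiplier_semigroup (S M : semigroupType)
    (i : {multiplicative S -> M}) : Prop :=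
  [/\ inverse_semigroup M,
      ideal_inclusion i
    & forall (T : semigroupType) (j : {multiplicative S -> T}),
        inverse_semigroup T -> ideal_inclusion j ->
        exists! theta : {multiplicative T -> M}, theta \o j =1 i].

(* Main.v *)
Require Import Defs.
From mathcomp Require Import all_boot all_classical.
From HB Require Import structures.

(** A multiplier of [S] is a map [l : S -> S] that has a partner [r] with
    [x * l y = r x * y]: left multiplication by an element of a larger
    semigroup containing [S] as an ideal is such a map, right multiplication by
    the same element being the partner. Multipliers compose, so they form a
    semigroup [M(S)], in which [s : S] is left multiplication by [s].

    An inverse semigroup is reductive ([reductive]): two elements with the same
    left multiplication, or the same right multiplication, are equal. Hence [S]
    embeds in [M(S)], and [l (x * y) = l x * y] ([linkedM]). So [s] followed by
    [l] is left multiplication by [l s], while [l] followed by [s] is left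
    multiplication by [r s]: the image of [S] is an ideal. If [S] is an ideal
    of [T], then [t : T] acts on [S] as the multiplier [x |-> t * x]; any
    homomorphism from [T] to [M(S)] over [S] must be this one, since a
    multiplier [l] is determined by its products [l s] with the [s : S].

    What remains is that [M(S)] is inverse. A semigroup is inverse as soon as
    it is regular and its idempotents commute ([inverse_semigroupP]), and both
    conditions follow from one observation ([linked_compatible]): for
    idempotents [e] and [f] of [S], the element [(l f)^-1 * l e] is idempotent.
    This is to be expected: in an inverse semigroup where [l] acts on [S] as an
    element, it is [f * (l^-1 * l) * e], a product of idempotents. It implies that
    the adjoint [x |-> (r x^-1)^-1] is an inverse of [l] ([linked_regular]),
    and that an idempotent multiplier sends idempotents to idempotents
    ([linked_idem]), which makes any two such multipliers commute. *)

Set Implicit Arguments.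
Unset Strict Implicit.
Unset Printing Implicit Defensive.

Local Open Scope group_scope.

(** * Inverse semigroups *)

Definition idem (S : semigroupType) (e : S) : Prop := e * e = e.

Definition mutually_inverse (S : semigroupType) (s t : S) : Prop :=
  s * t * s = s /\ t * s * t = t.

(** If [t] and [u] are inverses of [s], then commuting the idempotents [t * s]
    and [u * s], respectively [s * t] and [s * u], shows that both are equal to
    [u * s * t]. *)
Lemma inverse_semigroupP (S : semigroupType) :
  (forall s : S, exists t, mutually_inverse s t) ->
  (forall e f : S, idem e -> idem f -> e * f = f * e) ->
  inverse_semigroup S.
Proof.
move=> reg comm s; have [t [sts tst]] := reg s.
exists t; split=> [//|u [sus usu]].
have st_su : (s * t) * (s * u) = (s * u) * (s * t).
  by apply: comm; rewrite /idem !mulgA ?sts ?sus.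
have ts_us : (t * s) * (u * s) = (u * s) * (t * s).
  by apply: comm; rewrite /idem !mulgA ?tst ?usu.
transitivity (u * s * t).
  have -> : u * s * t = (u * s) * (t * s) * t by rewrite -[RHS]mulgA tst.
  by rewrite -ts_us -{1}tst -{1}sus !mulgA.
have -> : u * s * t = u * ((s * t) * (s * u)) by rewrite st_su !mulgA usu.
by rewrite !mulgA -!(mulgA u) sts mulgA usu.
Qed.

Section InverseSemigroup.

Variables (S : semigroupType) (hS : inverse_semigroup S).
Implicit Types x y e f : S.

Definition star x : S := sval (cid (hS x)).

Local Notation "x ^-1" := (star x) : group_scope.

Lemma mulgVg x : x * x^-1 * x = x.
Proof. by rewrite /star; case: cid => y /= [[]]. Qed.

Lemma mulVgV x : x^-1 * x * x^-1 = x^-1.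
Proof. by rewrite /star; case: cid => y /= [[]]. Qed.

Lemma star_uniq x y : mutually_inverse x y -> x^-1 = y.
Proof. by rewrite /star; case: cid => z /= [_ uniq_z] /uniq_z. Qed.

Lemma starK x : x^-1^-1 = x.
Proof. by apply: star_uniq; rewrite /mutually_inverse mulgVg mulVgV. Qed.

Lemma star_idem e : idem e -> e^-1 = e.
Proof. by move=> ee; apply: star_uniq; rewrite /mutually_inverse !ee. Qed.

Lemma idem_mulgV x : idem (x * x^-1).
Proof. by rewrite /idem !mulgA mulgVg. Qed.

Lemma idem_mulVg x : idem (x^-1 * x).
Proof. by rewrite /idem !mulgA mulVgV. Qed.

Lemma idemM e f : idem e -> idem f -> idem (e * f).
Proof.
move=> ee ff; set x := (e * f)^-1.
have xV : x * (e * f) * x = x by apply: mulVgV.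
have Vx : (e * f) * x * (e * f) = e * f by apply: mulgVg.
(* f x e is another inverse of e f, and this form makes x idempotent. *)
have x_eq : x = f * x * e.
  apply: star_uniq; split.
    by rewrite !mulgA -(mulgA e f f) ff -(mulgA _ e e) ee -mulgA Vx.
  by rewrite -{3}xV !mulgA -(mulgA _ e e) ee -(mulgA _ f f) ff.
have xx : idem x by rewrite /idem {1 2}x_eq [RHS]x_eq -{3}xV !mulgA.
by rewrite -[e * f](starK (e * f)) -/x (star_idem xx).
Qed.

(** Both [e * f] and [f * e] are inverses of [e * f]. *)
Lemma idemC e f : idem e -> idem f -> e * f = f * e.
Proof.
move=> ee ff; have ef := idemM ee ff; have fe := idemM ff ee.
rewrite -{1}(star_idem ef); apply: star_uniq; split.
  by rewrite !mulgA -(mulgA e f f) ff -(mulgA _ e e) ee -mulgA ef.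
by rewrite !mulgA -(mulgA f e e) ee -(mulgA _ f f) ff -mulgA fe.
Qed.

Lemma starM x y : (x * y)^-1 = y^-1 * x^-1.
Proof.
have C := idemC (idem_mulVg x) (idem_mulgV y).
apply: star_uniq; split.
  have -> : x * y * (y^-1 * x^-1) * (x * y)
            = x * ((y * y^-1) * (x^-1 * x)) * y by rewrite !mulgA.
  by rewrite -C !mulgA mulgVg -!mulgA (mulgA y) mulgVg.
have -> : y^-1 * x^-1 * (x * y) * (y^-1 * x^-1)
          = y^-1 * ((x^-1 * x) * (y * y^-1)) * x^-1 by rewrite !mulgA.
by rewrite C !mulgA mulVgV -!mulgA (mulgA x^-1) mulVgV.
Qed.

(** Testing on [c = a^-1 * a] and [c = b^-1 * b] gives [a = b * (a^-1 * a)]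
    and [b = a * (b^-1 * b)], and these two idempotents commute. *)
Lemma reductive a b : (forall c : S, a * c = b * c) -> a = b.
Proof.
move=> ab.
have a_b : a = b * (a^-1 * a) by rewrite -ab mulgA mulgVg.
have b_a : b = a * (b^-1 * b) by rewrite ab mulgA mulgVg.
transitivity (a * (b^-1 * b) * (a^-1 * a)); first by rewrite -b_a.
rewrite -mulgA (idemC (idem_mulVg b) (idem_mulVg a)) mulgA.
by rewrite [X in X * _]mulgA mulgVg -b_a.
Qed.

End InverseSemigroup.

(** * Linked maps on an inverse semigroup *)

Definition linked (S : semigroupType) (l r : S -> S) : Prop :=
  forall x y, x * l y = r x * y.

Section Linked.

Variables (S : semigroupType) (hS : inverse_semigroup S).
Implicit Types (l r : S -> S) (x y e f : S).

Local Notation "x ^-1" := (star hS x) : group_scope.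

Lemma reductive_left a b : (forall c : S, c * a = c * b) -> a = b.
Proof.
move=> ab; rewrite -[a](starK hS) -[b](starK hS); congr (_^-1).
apply: (reductive hS) => c.
by rewrite -[c](starK hS) -!starM ab.
Qed.

Lemma linkedM l r x y : linked l r -> l (x * y) = l x * y.
Proof.
by move=> lr; apply: reductive_left => c; rewrite lr !mulgA -lr.
Qed.

Definition adjoint (r : S -> S) : S -> S := fun x => (r x^-1)^-1.

Lemma adjointK l : adjoint (adjoint l) =1 l.
Proof. by move=> x; rewrite /adjoint !starK. Qed.

Lemma linked_adjoint l r : linked l r -> linked (adjoint r) (adjoint l).
Proof.
move=> lr x y; rewrite /adjoint -{1}[x](starK hS) -{2}[y](starK hS).
by rewrite -!starM lr.
Qed.

(** Let [g] be the range idempotent of [a = l f]. Then [a = r g * f] because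
    [g * l f = r g * f], and likewise [g * l e = r g * e]. Hence
    [a^-1 * l e = a^-1 * g * l e = f * ((r g)^-1 * r g) * e]. *)
Lemma linked_compatible l r e f :
  linked l r -> idem e -> idem f -> idem ((l f)^-1 * l e).
Proof.
move=> lr ee ff; set a := l f; set g := a * a^-1.
have aE : a = r g * f by rewrite -lr /g -/a mulgVg.
have -> : a^-1 * l e = f * ((r g)^-1 * r g) * e.
  rewrite -(mulVgV hS a) -[_ * a * _]mulgA -/g -(mulgA _ g) lr.
  by rewrite {1}aE starM (star_idem hS ff) !mulgA.
by apply: (idemM hS) => //; apply: (idemM hS) => //; apply: idem_mulVg.
Qed.

(** It suffices to compute at idempotents [e], since
    [l x = l (x * x^-1) * x]. Let [z] be the image of [a = l e] under the
    adjoint, with range idempotent [f]. Then [z = f * z = (l f)^-1 * l e] is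
    idempotent, so it commutes with [e]; as [z * e = z] and [e * z = a^-1 * a],
    it follows that [z = a^-1 * a]. Applying [l] to
    [z = e * (a^-1 * a)] gives back [a * (a^-1 * a) = a]. *)
Lemma linked_regular l r : linked l r -> forall x, l (adjoint r (l x)) = l x.
Proof.
move=> lr x; have lr' := linked_adjoint lr.
pose e := x * x^-1; have ee : idem e by apply: idem_mulgV.
suff le : l (adjoint r (l e)) = l e.
  have -> : x = e * x by rewrite /e mulgVg.
  by rewrite (linkedM _ _ lr) (linkedM _ _ lr') (linkedM _ _ lr) le.
set a := l e; set z := adjoint r a; pose f := z * z^-1.
have ff : idem f by apply: idem_mulgV.
have ae : a * e = a by rewrite /a -(linkedM _ _ lr) ee.
have ze : z * e = z by rewrite /z -(linkedM _ _ lr') ae.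
have zz : idem z.
  have -> : z = (l f)^-1 * l e.
    rewrite -[LHS](mulgVg hS) -/f {1}/z lr' /adjoint.
    by rewrite (star_idem hS ff).
  exact: linked_compatible lr ee ff.
have ez : e * z = a^-1 * a by rewrite /z lr' /adjoint (star_idem hS ee).
have -> : z = e * (a^-1 * a) by rewrite -ez mulgA ee (idemC hS ee zz) ze.
by rewrite (linkedM _ _ lr) -/a mulgA mulgVg.
Qed.

(** The range idempotent [g] of [a = l e] is fixed by [l], because [a] is;
    hence [a = g * a = (l g)^-1 * l e]. *)
Lemma linked_idem l r e :
  linked l r -> (forall x, l (l x) = l x) -> idem e -> idem (l e).
Proof.
move=> lr ll ee; pose g := l e * (l e)^-1.
have gg : idem g by apply: idem_mulgV.
have lg : l g = g by rewrite /g (linkedM _ _ lr) ll.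
have -> : l e = (l g)^-1 * l e by rewrite lg (star_idem hS gg) mulgVg.
exact: linked_compatible lr ee gg.
Qed.

(** On an idempotent [e], [l (m e) = l e * m e], a product of two
    idempotents. *)
Lemma linked_comm l r m n :
    linked l r -> linked m n ->
    (forall x, l (l x) = l x) -> (forall x, m (m x) = m x) ->
  forall x, l (m x) = m (l x).
Proof.
move=> lr mn ll mm x.
have [e ee ->] : exists2 e, idem e & x = e * x.
  by exists (x * x^-1); [apply: idem_mulgV | rewrite mulgVg].
have prod k h k' h' : linked k h -> linked k' h' ->
    (forall y, k' (k' y) = k' y) -> k (k' e) = k e * k' e.
  move=> kh kh' kk'; have k'e := linked_idem kh' kk' ee.
  rewrite -(linkedM _ _ kh) (idemC hS ee k'e).
  by rewrite -(linkedM _ _ kh') ee.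
rewrite !(linkedM _ _ lr, linkedM _ _ mn); congr (_ * x).
rewrite (prod _ _ _ _ lr mn mm) (prod _ _ _ _ mn lr ll).
exact: (idemC hS (linked_idem lr ll ee) (linked_idem mn mm ee)).
Qed.

End Linked.

(** * The semigroup of multipliers *)

(** The partner is only asserted to exist, so that equality of multipliers is
    equality of maps. *)
Record multiplier (S : semigroupType) := Multiplier {
  mult_fun :> S -> S;
  mult_linked : exists r, linked mult_fun r
}.

Section Multiplier.

Variable S : semigroupType.
Implicit Types l m : multiplier S.

HB.instance Definition _ := gen_eqMixin (multiplier S).
HB.instance Definition _ := gen_choiceMixin (multiplier S).

Lemma multiplierP l m : l =1 m -> l = m.
Proof.
case: l m => [l lP] [m mP] /= /funext lm; rewrite lm in lP *.
by congr Multiplier; apply: Prop_irrelevance.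
Qed.

Lemma linked_comp l m : exists r, linked (l \o m) r.
Proof.
have [r lr] := mult_linked l; have [n mn] := mult_linked m.
by exists (n \o r) => x y /=; rewrite lr mn.
Qed.

Definition mult_comp l m : multiplier S := Multiplier (linked_comp l m).

Lemma mult_compA : associative mult_comp.
Proof. by move=> l m k; apply: multiplierP. Qed.

HB.instance Definition _ := isSemigroup.Build (multiplier S) mult_compA.

Lemma mult_mulE l m x : (l * m) x = l (m x).
Proof. by []. Qed.

Lemma linked_mulg (s : S) : exists r, linked (fun x => s * x) r.
Proof. by exists (fun x => x * s) => x y; rewrite mulgA. Qed.

Definition inner (s : S) : multiplier S := Multiplier (linked_mulg s).

Lemma innerM : {morph inner : s t / s * t}.
Proof. by move=> s t; apply: multiplierP => x /=; rewrite mulgA. Qed.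

HB.instance Definition _ :=
  isMultiplicative.Build S (multiplier S) inner innerM.

Hypothesis hS : inverse_semigroup S.

Lemma inner_inj : injective inner.
Proof.
move=> s t st; apply: (reductive hS) => c.
by rewrite -[LHS]/(inner s c) st.
Qed.

Lemma mult_inner l (s : S) : l * inner s = inner (l s).
Proof.
have [r lr] := mult_linked l.
by apply: multiplierP => x; rewrite mult_mulE /= (linkedM hS _ _ lr).
Qed.

Lemma inner_ideal : ideal_inclusion inner.
Proof.
split; first exact: inner_inj.
move=> l _ [s _ <-]; split; first by exists (l s); rewrite ?mult_inner.
have [r lr] := mult_linked l; exists (r s) => //.
by apply: multiplierP => x; rewrite mult_mulE /= lr.
Qed.

Lemma multiplier_inverse : inverse_semigroup (multiplier S).
Proof.
apply: inverse_semigroupP => [l|l m ll mm].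
  have [r lr] := mult_linked l; have lr' := linked_adjoint hS lr.
  exists (Multiplier (ex_intro _ _ lr')).
  split; apply: multiplierP => x; rewrite !mult_mulE /=.
    exact: (linked_regular hS lr).
  by rewrite -[l _](adjointK hS) (linked_regular hS lr').
have [r lr] := mult_linked l; have [n mn] := mult_linked m.
apply: multiplierP; apply: (linked_comm hS lr mn) => x.
  by rewrite -mult_mulE ll.
by rewrite -mult_mulE mm.
Qed.

End Multiplier.

(** * Universality *)

Section Universality.

Variables (S T : semigroupType) (j : {multiplicative S -> T}).
Hypotheses (hS : inverse_semigroup S) (hj : ideal_inclusion j).

(** Left multiplication by [t : T] on the ideal [j S], transported to [S];
    the partner is right multiplication. *)
Lemma ideal_action (t : T) :
  exists l : multiplier S, forall x, j (l x) = t * j x.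
Proof.
have [j_inj j_ideal] := hj.
have jS x : range j (j x) by exists x.
have left_in x : exists y, j y = t * j x.
  by have [[y _ jy] _] := j_ideal t _ (jS x); exists y.
have right_in x : exists y, j y = j x * t.
  by have [_ [y _ jy]] := j_ideal t _ (jS x); exists y.
have [[l lE] [r rE]] := (choice left_in, choice right_in).
have lr : linked l r.
  by move=> x y; apply: j_inj; rewrite !gmulfM lE rE mulgA.
by exists (Multiplier (ex_intro _ _ lr)).
Qed.

Definition extension (t : T) : multiplier S := sval (cid (ideal_action t)).

Lemma extensionE t x : j (extension t x) = t * j x.
Proof. by rewrite /extension; case: cid. Qed.

Lemma extensionM : {morph extension : s t / s * t}.
Proof.
have [j_inj _] := hj; move=> s t; apply: multiplierP => x; apply: j_inj.
by rewrite mult_mulE !extensionE mulgA.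
Qed.

HB.instance Definition _ :=
  isMultiplicative.Build T (multiplier S) extension extensionM.

Lemma extension_inner : extension \o j =1 @inner S.
Proof.
have [j_inj _] := hj; move=> s; apply: multiplierP => x; apply: j_inj.
by rewrite extensionE gmulfM.
Qed.

(** For a homomorphism [theta] over [S], the product of [theta t] and the image
    of [x : S] is [theta (t * j x)], the image of [extension t x]; by
    [mult_inner] it is also the image of [theta t x]. *)
Lemma extension_uniq (theta : {multiplicative T -> multiplier S}) :
  theta \o j =1 @inner S -> theta =1 extension.
Proof.
move=> theta_j t; apply: multiplierP => x; apply: (inner_inj hS).
rewrite -(mult_inner hS) -!theta_j /=.
by rewrite -gmulfM -extensionE.
Qed.

End Universality.

Lemma multiplicativeP (T M : magmaType) (f g : {multiplicative T -> M}) :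
  f =1 g -> f = g.
Proof.
case: f g => [f [[fM]]] [g [[gM]]] /= /funext fg; rewrite /= in fg.
by subst g; rewrite (Prop_irrelevance fM gM).
Qed.

Theorem proposition6p4 (S : semigroupType) (hS : inverse_semigroup S) :
  exists (M : semigroupType) (i : {multiplicative S -> M}),
    multiplier_semigroup i.
Proof.
exists (multiplier S), (@inner S); split.
- exact: multiplier_inverse.
- exact: inner_ideal.
- move=> T j _ hj; exists (extension hj); split; first exact: extension_inner.
  move=> theta theta_j; apply: multiplicativeP => t.
  exact/esym/(extension_uniq hS hj theta_j).
Qed.
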